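(* Let $G$ be a finite simple graph without isolated vertices, with vertex set $V=\{x_1,\ldots,x_n\}$, let $\Upsilon(G)$ be the family of minimal vertex covers of $G$, let $0\neq a=(a_1,\ldots,a_n)\in\mathbb{N}^n$ and let $b\in\mathbb{N}$. (i) If $G$ is bipartite, then $a$ is an irreducible $b$-cover of $G$ if and only if either $b=0$ and $a=e_i$ for some $1\leq i\leq n$, or $b=1$ and $a=\sum_{x_i\in C}e_i$ for some $C\in\Upsilon(G)$. (ii) If $G$ is non-bipartite, then $a$ is an irreducible $b$-cover of $G$ if and only if one of the following holds: (a) $b=0$ and $a=e_i$ for some $1\leq i\leq n$; (b) $b=1$ and $a=\sum_{x_i\in C}e_i$ for some $C\in\Upsilon(G)$; (c) $b=2$ and $a=(1,\ldots,1)$; (d) $b=2$ and there is a nonempty independent set of vertices $A$ of $G$ such that $a_i=0$ if $x_i\in A$, $a_i=2$ if $x_i\in N_G(A)$, and $a_i=1$ if $x_i\in V\setminus(A\cup N_G(A))$, and such that $(\mathrm{d}_1)$ $N_G(A)$ is not a vertex cover of $G$ and $V\neq A\cup N_G(A)$, and $(\mathrm{d}_2)$ the induced subgraph $\langle V\setminus(A\cup N_G(A))\rangle$ has no isolated vertices and is not bipartite.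
   Context: $\mathbb{N}=\{0,1,2,\ldots\}$ and $e_i$ is the $i$th unit vector. For $0\neq a\in\mathbb{N}^n$ and $b\in\mathbb{N}$, $a$ is a $b$-cover of $G$ if $a_i+a_j\geq b$ for every edge $\{x_i,x_j\}$ of $G$. A $b$-cover $a$ of $G$ is reducible if there are an $i$-cover $c$ and a $j$-cover $d$ of $G$ (with $i,j\in\mathbb{N}$; covers are nonzero vectors by definition) such that $a=c+d$ and $b=i+j$; otherwise the $b$-cover $a$ is irreducible. A vertex cover of $G$ is a set of vertices meeting every edge; it is minimal if no proper subset is a vertex cover. $N_G(A)$ is the set of vertices of $G$ adjacent to at least one vertex of $A$. A set of vertices is independent if no two of its vertices are adjacent. $\langle S\rangle$ denotes the induced subgraph of $G$ on the vertex set $S$. *)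

(* Defs.v *)
From HB Require Import structures.
From mathcomp Require Import all_boot all_order all_algebra.

Set Implicit Arguments.
Unset Strict Implicit.
Unset Printing Implicit Defensive.

Import GRing.Theory.
Local Open Scope ring_scope.

(* A simple graph on T is its adjacency relation e : rel T, which the theorem
   assumes symmetric and irreflexive. *)

Definition no_isolated (T : finType) (e : rel T) : Prop :=
  forall x : T, exists y : T, e x y.

Definition bipartite (T : finType) (e : rel T) : Prop :=
  exists X : {set T}, forall x y : T, e x y -> (x \in X) != (y \in X).

Definition induced (T : finType) (e : rel T) (S : {set T}) :
    rel {x : T | x \in S} :=
  relpre val e.

Arguments induced {T} e S _ _.

Definition independent (T : finType) (e : rel T) (A : {set T}) : Prop :=
  forall x y : T, x \in A -> y \in A -> ~~ e x y.

Definition nbhd (T : finType) (e : rel T) (A : {set T}) : {set T} :=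
  [set y | [exists x in A, e x y]].

Definition vertex_cover (T : finType) (e : rel T) (C : {set T}) : bool :=
  [forall x, forall y, e x y ==> (x \in C) || (y \in C)].

Definition minimal_vertex_covers (T : finType) (e : rel T) : {set {set T}} :=
  [set C | minset (vertex_cover e) C].

(* Vectors of N^n are row matrices; the i-th coordinate of a is a 0 i. *)
Definition bcover (n : nat) (e : rel 'I_n) (b : nat) (a : 'rV[nat]_n) : Prop :=
  a != 0 /\ forall i j : 'I_n, e i j -> (b <= a 0%R i + a 0%R j)%N.

Definition reducible (n : nat) (e : rel 'I_n) (b : nat) (a : 'rV[nat]_n) :
    Prop :=
  exists (i j : nat) (c d : 'rV[nat]_n),
    [/\ bcover e i c, bcover e j d, a = c + d & b = (i + j)%N].

Definition irreducible_bcover (n : nat) (e : rel 'I_n) (b : nat)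
    (a : 'rV[nat]_n) : Prop :=
  bcover e b a /\ ~ reducible e b a.

Definition unit_vec (n : nat) (i : 'I_n) : 'rV[nat]_n := delta_mx 0 i.

(* Main.v *)
Require Import Defs.
From mathcomp Require Import all_boot all_order all_algebra.
From mathcomp Require Import zify.

(* Call a b-cover tight if every vertex of positive weight lies on an edge of
   total weight exactly b.  For b > 0, irreducible covers are tight (otherwise a
   unit vector splits off), and conversely a tight b-cover cannot be split as a
   b-cover plus a 0-cover.  For b = 1 tight covers are the minimal vertex
   covers.  Truncating the values of a to 0, 1, 2 according to a_i = 0,
   0 < a_i < b, b <= a_i splits off a 2-cover from every b-cover with b >= 2, so
   nothing is irreducible for b > 2.  A tight 2-cover is a sum of two 1-covers
   if and only if the graph induced on its vertices of weight 1 is bipartite;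
   the set A of the theorem is the set of vertices of weight 0. *)

Set Implicit Arguments.
Unset Strict Implicit.
Unset Printing Implicit Defensive.

Import GRing.Theory.
Local Open Scope ring_scope.

Definition tight (n : nat) (e : rel 'I_n) (b : nat) (a : 'rV[nat]_n) : Prop :=
  forall i, (0 < a 0%R i)%N -> exists2 j, e i j & (a 0%R i + a 0%R j)%N = b.

(** [X] is one side of a 2-colouring of the graph on the vertices of weight 1; phrasing it on all
    vertices avoids the subtype in [induced]. *)
Definition splits_ones (n : nat) (e : rel 'I_n) (a : 'rV[nat]_n)
    (X : {set 'I_n}) : Prop :=
  forall i j, e i j -> a 0%R i = 1%N -> a 0%R j = 1%N -> (i \in X) != (j \in X).

(** * Entries of tight covers and of unit vectors *)

Lemma tight_le (n : nat) (e : rel 'I_n) (b : nat) (a : 'rV[nat]_n) :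
  tight e b a -> forall i, (a 0%R i <= b)%N.
Proof. by move=> ta i; case: posnP (ta i) => [->|_ [] // j _]; lia. Qed.

Lemma natmx_addE (n : nat) (c d : 'rV[nat]_n) i :
  (c + d) 0 i = (c 0%R i + d 0%R i)%N.
Proof. by rewrite mxE. Qed.

Lemma natmx_neq0P (n : nat) (a : 'rV[nat]_n) :
  reflect (exists i, (0 < a 0%R i)%N) (a != 0).
Proof.
apply: (iffP idP) => [a0 | [i ai]]; last first.
  by apply: contraTneq ai => ->; rewrite mxE.
apply/existsP; apply: contra_neqT a0 => /existsPn a0.
by apply/rowP => i; move: (a0 i); rewrite mxE lt0n negbK => /eqP.
Qed.

Lemma unit_vecE (n : nat) (i j : 'I_n) : unit_vec i 0 j = (j == i) :> nat.
Proof. by rewrite mxE eqxx; case: (j == i). Qed.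

Lemma sum_unit_vecE (n : nat) (C : {set 'I_n}) j :
  (\sum_(i in C) unit_vec i) 0 j = (j \in C) :> nat.
Proof.
rewrite summxE; case: (boolP (j \in C)) => jC.
  rewrite (bigD1 j) //= unit_vecE eqxx big1 ?addr0 // => i /andP[_ /negPf ij].
  by rewrite unit_vecE eq_sym ij.
rewrite big1 // => i iC; rewrite unit_vecE.
by case: eqP iC jC => // <- ->.
Qed.

(** Every nonzero vector is a 0-cover, so irreducibility here means not being a sum of two nonzero
    vectors. *)
Lemma irreducible_0cover (n : nat) (e : rel 'I_n) (a : 'rV[nat]_n) :
  a != 0 ->
  irreducible_bcover e 0 a <-> exists i : 'I_n, a = unit_vec i.
Proof.
move=> a0; split=> [[_ irr] | [i ->]]; last first.
  split; first split=> //.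
    by apply/natmx_neq0P; exists i; rewrite unit_vecE eqxx.
  move=> [_ [_ [c [d [[/natmx_neq0P[k ck] _]
    [/natmx_neq0P[l dl] _] /rowP H _]]]]].
  have := H k; have := H l; rewrite !natmx_addE !unit_vecE => Hl Hk.
  (* Only coordinate [i] of the sum is nonzero, so both [c] and [d] are positive there and their sum
     is at least 2. *)
  have ki : k = i by apply/eqP; lia.
  have li : l = i by apply/eqP; lia.
  by subst k l; lia.
have /natmx_neq0P[i ai] := a0.
exists i; apply/eqP/negPn/negP => /eqP ne; apply: irr.
pose d : 'rV[nat]_n := \row_k (a 0%R k - unit_vec i 0%R k)%N.
have ad : a = unit_vec i + d.
  apply/rowP => k; rewrite natmx_addE [d _ _]mxE !unit_vecE.
  by case: eqP => [->|] //=; lia.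
exists 0%N, 0%N, (unit_vec i), d; split=> //.
  by split=> //; apply/natmx_neq0P; exists i; rewrite unit_vecE eqxx.
by split=> //; apply/eqP => d0; apply: ne; rewrite ad d0 addr0.
Qed.

(** * Tightness of covers with [b > 0] *)

Section NoIsolated.

Context (n : nat) (e : rel 'I_n).
Hypotheses (e_sym : symmetric e) (e_irr : irreflexive e).
Hypothesis e_noiso : no_isolated e.

(** An edge at [i] has total weight at least [b > 0], hence an end of positive weight. The argument
    [i] rules out the empty graph. *)
Lemma bcoverW (b : nat) (a : 'rV[nat]_n) (i : 'I_n) : (0 < b)%N ->
  (forall i j, e i j -> (b <= a 0%R i + a 0%R j)%N) -> bcover e b a.
Proof.
move=> b0 H; split=> //; apply/natmx_neq0P.
have [j eij] := e_noiso i; have := H _ _ eij.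
case: (posnP (a 0%R i)) => ai; last by exists i.
by exists j; lia.
Qed.

Lemma irreducible_tight (b : nat) (a : 'rV[nat]_n) : (0 < b)%N ->
  irreducible_bcover e b a -> tight e b a.
Proof.
move=> b0 [[_ cov] irr] i ai.
have [/exists_inP[j eij /eqP E]|/exists_inPn nt] :=
  boolP [exists j in e i, (a 0%R i + a 0%R j)%N == b]; first by exists j.
case: irr; pose c : 'rV[nat]_n := \row_k (a 0%R k - unit_vec i 0%R k)%N.
exists b, 0%N, c, (unit_vec i); split; last by rewrite addn0.
(* Every edge at [i] weighs at least [b + 1], so it survives the loss of one unit at [i]; a loop
   would lose two. *)
- apply: (bcoverW i) => // k l ekl; have := cov _ _ ekl.
  rewrite ![c _ _]mxE !unit_vecE.
  case: (altP (k =P i)) => [ki|_]; case: (altP (l =P i)) => [li|_] /=; try lia.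
  + by subst k l; rewrite e_irr in ekl.
  + by subst k; have := nt l ekl; lia.
  + by subst l; rewrite e_sym in ekl; have := nt k ekl; lia.
- by split=> //; apply/natmx_neq0P; exists i; rewrite unit_vecE eqxx.
- apply/rowP => k; rewrite natmx_addE [c _ _]mxE !unit_vecE.
  by case: eqP => [->|] //=; lia.
Qed.

(** At a vertex where [d] is positive, [a] has an edge of total [b], which leaves less than [b] for
    [c]. *)
Lemma tight_not_add_0cover (b : nat) (a c d : 'rV[nat]_n) :
  tight e b a -> bcover e b c -> bcover e 0 d -> a = c + d -> False.
Proof.
move=> ta [_ cov] [/natmx_neq0P[k dk] _] acd.
have [|j ekj] := ta k; first by rewrite acd natmx_addE; lia.
by have := cov _ _ ekj; rewrite acd !natmx_addE; lia.
Qed.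

(** * Covers with [b = 1] *)

Lemma irreducible_1cover (a : 'rV[nat]_n) :
  irreducible_bcover e 1 a <-> bcover e 1 a /\ tight e 1 a.
Proof.
split=> [irr|[cov ta]].
  by split; [case: irr | apply: irreducible_tight].
split=> // -[[|[|i]] [[|[|j]] [c [d [cc cd acd //]]]]] _.
  by apply: (tight_not_add_0cover ta cd cc); rewrite addrC.
exact: (tight_not_add_0cover ta cc cd).
Qed.

(** Tightness makes the entries 0 or 1 and gives each [i] in the support an edge covered by [i]
    alone, which is minimality of the support. *)
Lemma tight_1cover (a : 'rV[nat]_n) : a != 0 ->
  bcover e 1 a /\ tight e 1 a <->
  exists2 C : {set 'I_n},
    C \in minimal_vertex_covers e & a = \sum_(i in C) unit_vec i.
Proof.
move=> a0; split=> [[[_ cov] ta] | [C]].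
  pose C := [set i | (0 < a 0%R i)%N]; exists C; last first.
    apply/rowP => i; rewrite sum_unit_vecE inE.
    by case: posnP => [->|ai] //; have [j _] := ta i ai; lia.
  rewrite inE; apply/minsetP; split.
    apply/forallP => i; apply/forallP => j; apply/implyP => /cov.
    by rewrite !inE; lia.
  move=> D /forallP Dc DC; apply/eqP; rewrite eqEsubset DC /=.
  apply/subsetP => i; rewrite inE => ai.
  have [j eij aij] := ta i ai.
  have /forallP/(_ j)/implyP/(_ eij)/orP[//|/(subsetP DC)] := Dc i.
  by rewrite inE; lia.
rewrite inE => /minsetP[/forallP Cc Cmin] aE; split.
  split=> // i j eij; rewrite aE !sum_unit_vecE.
  by have /forallP/(_ j)/implyP/(_ eij) := Cc i; do 2!case: (_ \in C).
move=> i; rewrite {1}aE sum_unit_vecE lt0b => iC.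
have [/exists_inP[j eij jC]|/exists_inPn H] :=
    boolP [exists j in e i, j \notin C].
  by exists j => //; rewrite aE !sum_unit_vecE iC (negPf jC).
suff /Cmin/(_ (subD1set _ _))/setP/(_ i) : vertex_cover e (C :\ i).
  by rewrite !inE eqxx iC.
apply/forallP => k; apply/forallP => l; apply/implyP => ekl.
have /forallP/(_ l)/implyP/(_ ekl) := Cc k; rewrite !inE.
case: (altP (k =P i)) => [ki|_] /=; case: (altP (l =P i)) => [li|_] //=.
- by subst k l; rewrite e_irr in ekl.
- by subst k; have := H l ekl; rewrite negbK => ->.
- by subst l; rewrite e_sym in ekl; have := H k ekl; rewrite negbK => ->.
Qed.

(** * Covers with [b > 2] *)

Lemma bcover_gt2_reducible (b : nat) (a : 'rV[nat]_n) : (2 < b)%N ->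
  bcover e b a -> reducible e b a.
Proof.
move=> b2 [/natmx_neq0P[i0 _] cov].
(* On an edge either both ends are positive or one weighs at least [b], so [c] is a 2-cover. As
   [b - 2 > 0], the edge bounds alone make [d] nonzero. *)
pose c : 'rV[nat]_n := \row_k ((0 < a 0%R k) + (b <= a 0%R k))%N.
pose d : 'rV[nat]_n := \row_k (a 0%R k - c 0%R k)%N.
exists 2%N, (b - 2)%N, c, d; split; last by lia.
- by apply: (bcoverW i0) => // i j /cov; rewrite !mxE; lia.
- by apply: (bcoverW i0) => [|i j /cov]; [lia | rewrite !mxE; lia].
- by apply/rowP => k; rewrite natmx_addE !mxE; lia.
Qed.

(** * Covers with [b = 2] *)

Lemma irreducible_2cover (a : 'rV[nat]_n) :
  irreducible_bcover e 2 a <->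
  [/\ bcover e 2 a, tight e 2 a & forall X, ~ splits_ones e a X].
Proof.
split=> [irr | [cov ta nX]].
  have ta := irreducible_tight (isT : 0 < 2)%N irr.
  case: irr => [[a0 cov] irr]; split=> // X sX; apply: irr.
  have [i0 _] := natmx_neq0P _ a0.
  have a2 := tight_le ta.
  (* Each weight 2 is shared equally; each weight 1 goes to [c] on [X] and to [d] off [X], so an
     edge with both weights 1 serves both. *)
  pose c : 'rV[nat]_n :=
    \row_k ((a 0%R k == 2) || (a 0%R k == 1) && (k \in X) : nat)%N.
  pose d : 'rV[nat]_n := \row_k (a 0%R k - c 0%R k)%N.
  exists 1%N, 1%N, c, d; split=> //.
  - apply: (bcoverW i0) => // i j eij; rewrite !mxE.
    have := cov _ _ eij; have := sX _ _ eij; have := a2 i; have := a2 j.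
    by case: (i \in X) (j \in X) => [] []; lia.
  - apply: (bcoverW i0) => // i j eij; rewrite !mxE.
    have := cov _ _ eij; have := sX _ _ eij; have := a2 i; have := a2 j.
    by case: (i \in X) (j \in X) => [] []; lia.
  - by apply/rowP => k; rewrite natmx_addE !mxE; lia.
split=> // -[[|[|[|i]]] [[|[|[|j]]] [c [d [cc cd acd //]]]]] _.
- by apply: (tight_not_add_0cover ta cd cc); rewrite addrC.
(* On an edge with both weights 1, the 1-covers [c] and [d] have totals adding up to 2, so [c] is 1
   at exactly one end. *)
- apply: (nX [set k | c 0%R k == 1%N]) => k l ekl ak al; rewrite !inE.
  case: cc cd => [_ /(_ _ _ ekl) +] [_ /(_ _ _ ekl)].
  by move: ak al; rewrite acd !natmx_addE; lia.
- exact: (tight_not_add_0cover ta cc cd).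
Qed.

Lemma bipartite_splits_ones (a : 'rV[nat]_n) :
  bipartite e -> exists X, splits_ones e a X.
Proof. by move=> [X eX]; exists X => i j /eX. Qed.

Lemma splits_onesP (a : 'rV[nat]_n) (B : {set 'I_n}) :
  (forall i, (i \in B) = (a 0%R i == 1%N)) ->
  (exists X, splits_ones e a X) <-> bipartite (induced e B).
Proof.
move=> aB; split=> [[X sX] | [X sX]].
  exists [set u | val u \in X] => u v euv; rewrite !inE.
  by apply: sX => //; apply/eqP; rewrite -aB; apply: valP.
exists (val @: X) => i j eij /eqP; rewrite -aB => iB /eqP; rewrite -aB => jB.
have := sX (Sub i iB) (Sub j jB) eij.
by rewrite -!(mem_imset _ _ val_inj) !SubK.
Qed.

(** Neighbours of weight 0 vertices weigh 2, and tightness gives each weight 2 vertex such a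
    neighbour. An empty [A] is allowed and corresponds to the all-ones vector. *)
Lemma tight_2cover (a : 'rV[nat]_n) :
  [/\ bcover e 2 a, tight e 2 a & forall X, ~ splits_ones e a X] <->
  exists A : {set 'I_n},
    let B := [set: 'I_n] :\: (A :|: nbhd e A) in
    [/\ independent e A,
        [/\ forall i, i \in A -> a 0%R i = 0%N,
            forall i, i \in nbhd e A -> a 0%R i = 2%N
          & forall i, i \in B -> a 0%R i = 1%N],
        ~~ vertex_cover e (nbhd e A) /\ [set: 'I_n] != A :|: nbhd e A
      & no_isolated (induced e B) /\ ~ bipartite (induced e B)].
Proof.
have nbhdP (A : {set 'I_n}) i :
  reflect (exists2 j, j \in A & e j i) (i \in nbhd e A).
  by rewrite inE; apply: exists_inP.
split=> [[[a0 cov] ta nX] | [A]].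
  have a2 := tight_le ta.
  pose A := [set i | a 0%R i == 0%N]; exists A => B.
  have NA i : (i \in nbhd e A) = (a 0%R i == 2%N).
    apply/nbhdP/eqP => [[j] | ai].
      by rewrite inE => /eqP aj /cov; have := a2 i; lia.
    have [|j eij aij] := ta i; first by lia.
    by exists j; rewrite ?inE ?(e_sym j) //; lia.
  have aB i : (i \in B) = (a 0%R i == 1%N).
    by rewrite in_setD in_setU inE NA in_setT andbT; have := a2 i; lia.
  have nB : ~ bipartite (induced e B) by move/(splits_onesP aB) => [X /nX].
  split; last 1 first.
  - split=> // -[i iB]; have := iB; rewrite aB => /eqP ai.
    have [|j eij aij] := ta i; first by lia.
    have jB : j \in B by rewrite aB; lia.
    by exists (Sub j jB).
  - move=> i j; rewrite !inE => /eqP ai /eqP aj.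
    by apply/negP => /cov; lia.
  - split=> i; first by rewrite inE => /eqP.
      by rewrite NA => /eqP.
    by rewrite aB => /eqP.
  - split.
      (* If every edge had an end of weight 2, no edge would join two weights 1, and [set0] would
         split them vacuously. *)
      apply/negP => /forallP Nc; apply: (nX set0) => i j eij ai aj.
      by have /forallP/(_ j)/implyP/(_ eij) := Nc i; rewrite !NA ai aj.
    apply/eqP => VE; apply: nB; exists set0 => -[i iB].
    by exfalso; move: iB; rewrite /B -VE setDv inE.
set B := _ :\: _ => -[indA [aA aN aB] [_ _] [isoB nB]].
have part i : [\/ i \in A, i \in nbhd e A | i \in B].
  by rewrite in_setD in_setU in_setT andbT;
    case: (i \in A); case: (i \in nbhd e A); constructor.
have cov i j : e i j -> (2 <= a 0%R i + a 0%R j)%N.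
  move=> eij; case: (part i) => iP.
  - by rewrite (aN j) ?leq_addl //; apply/nbhdP; exists i.
  - by rewrite (aN i).
  case: (part j) => jP; last by rewrite (aB i) ?(aB j).
    by rewrite (aN i) //; apply/nbhdP; exists j; rewrite // e_sym.
  by rewrite (aN j) ?leq_addl.
have aBE i : (i \in B) = (a 0%R i == 1%N).
  case: (part i) => iP; last by rewrite (aB i iP) iP.
    by rewrite (aA i) // /B !inE iP.
  by rewrite (aN i) // /B in_setD in_setU iP orbT.
split; last by move=> X sX; apply: nB; apply/(splits_onesP aBE); exists X.
  (* For [a = 0] the set [B] would be empty, and the graph without vertices is bipartite. *)
  split=> //; apply/eqP => aE; apply: nB; exists set0 => -[i iB].
  by exfalso; move: iB; rewrite aBE aE mxE.
move=> i; case: (part i) => iP; first by rewrite aA.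
  case/nbhdP: (iP) => j jA eji _; exists j; first by rewrite e_sym.
  by rewrite (aN i) ?(aA j).
case: (isoB (Sub i iP)) => -[j jB] eij _; exists j => //.
by rewrite (aB i) ?(aB j).
Qed.

End NoIsolated.

(** * Assembly of the cases according to [b] *)

Theorem theorem2p7 (n : nat) (e : rel 'I_n) (e_sym : symmetric e)
    (e_irr : irreflexive e) (e_noiso : no_isolated e)
    (a : 'rV[nat]_n) (a_neq0 : a != 0) (b : nat) :
  (bipartite e ->
     (irreducible_bcover e b a <->
        (b = 0%N /\ exists i : 'I_n, a = unit_vec i) \/
        (b = 1%N /\ exists2 C : {set 'I_n},
           C \in minimal_vertex_covers e & a = \sum_(i in C) unit_vec i)))
  /\
  (~ bipartite e ->
     (irreducible_bcover e b a <->
        [\/ b = 0%N /\ exists i : 'I_n, a = unit_vec i,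
            b = 1%N /\ exists2 C : {set 'I_n},
              C \in minimal_vertex_covers e & a = \sum_(i in C) unit_vec i,
            b = 2%N /\ a = const_mx 1%N
          | b = 2%N /\ exists A : {set 'I_n},
              let B := [set: 'I_n] :\: (A :|: nbhd e A) in
              [/\ A != set0 /\ independent e A,
                  [/\ forall i, i \in A -> a 0 i = 0%N,
                      forall i, i \in nbhd e A -> a 0 i = 2%N
                    & forall i, i \in B -> a 0 i = 1%N],
                  ~~ vertex_cover e (nbhd e A) /\
                    [set: 'I_n] != A :|: nbhd e A
                & no_isolated (induced e B) /\
                    ~ bipartite (induced e B)]])).
have irr0 := irreducible_0cover e a_neq0.
have irr1 := iff_trans (irreducible_1cover e_sym e_irr e_noiso a)
  (tight_1cover e_sym e_irr a_neq0).
have irr2 := irreducible_2cover e_sym e_irr e_noiso a.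
have irr3 k : ~ irreducible_bcover e k.+3 a.
  by case=> cov; apply; apply: (bcover_gt2_reducible e_noiso).
split=> [bip | nbip].
  split=> [irr | [[-> /irr0]|[-> /irr1]] //].
  case: b irr => [/irr0 H|[/irr1 H|[/irr2[_ _ nX]|k /irr3 //]]].
  - by left.
  - by right.
  - by have [X /nX] := bipartite_splits_ones a bip.
split=> [irr |
  [[-> /irr0]|[-> /irr1]|[-> aE]|[-> [A [[_ indA] aA dA dA']]]] //].
- case: b irr => [/irr0 H|[/irr1 H|[/irr2/(tight_2cover e_sym)[A]|k /irr3 //]]].
  + exact: Or41.
  + exact: Or42.
  (* An empty [A] makes [B] the whole vertex set, which is case (c); otherwise case (d) holds. *)
  case: (altP (A =P set0)) => [-> [_ [_ _ aB] _ _]|A0 [indA aA dA dA']].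
    apply: Or43; split=> //; apply/rowP => i; rewrite mxE aB // in_setD in_setT.
    rewrite in_setU in_set0 andbT /= inE; apply/exists_inPn => j.
    by rewrite in_set0.
  by apply: Or44; split=> //; exists A.
- apply/irr2; split=> [|i _|X sX].
  + by split=> // i j _; rewrite aE !mxE.
  + by have [j eij] := e_noiso i; exists j; rewrite // aE !mxE.
  (* For the all-ones vector, splitting the ones is a bipartition of the whole graph. *)
  + by apply: nbip; exists X => i j /sX; apply; rewrite aE mxE.
- by apply/irr2/(tight_2cover e_sym); exists A.
Qed.
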